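(* Let $r\in\mathbb{N}$, let $G=(g_1,\ldots,g_r)$ be any system of polynomials with integer coefficients, let $m_1,\ldots,m_r\in\mathbb{N}$ and $m=\operatorname{lcm}(m_1,\ldots,m_r)$. Define $$E_G(m_1,\ldots,m_r)=\frac1m\sum_{k=1}^m c_{m_1}(g_1(k))\cdots c_{m_r}(g_r(k)).$$ Then $$E_G(m_1,\ldots,m_r)=\sum_{d_1\mid m_1,\ldots,d_r\mid m_r}\frac{d_1\mu(m_1/d_1)\cdots d_r\mu(m_r/d_r)}{\operatorname{lcm}(d_1,\ldots,d_r)}\,N_G(d_1,\ldots,d_r).$$
   Context: For $n\in\mathbb{N}$ and $k\in\mathbb{Z}$, $c_n(k)=\sum_{1\le j\le n,\ \gcd(j,n)=1}\exp(2\pi i jk/n)$ is the Ramanujan sum. $\mu$ is the Möbius function. For $d_1,\ldots,d_r\in\mathbb{N}$, $N_G(d_1,\ldots,d_r)$ denotes the number of residues $x$ modulo $\operatorname{lcm}(d_1,\ldots,d_r)$ satisfying simultaneously $g_1(x)\equiv 0 \pmod{d_1},\ldots,g_r(x)\equiv 0\pmod{d_r}$. *)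

(* Defs.v *)
From HB Require Import structures.
From mathcomp Require Import all_boot all_order all_algebra.
From mathcomp Require Import complex.
From mathcomp Require Import reals sequences exp trigo.

Set Implicit Arguments.
Unset Strict Implicit.
Unset Printing Implicit Defensive.

Import Order.TTheory GRing.Theory Num.Theory.
Local Open Scope ring_scope.
Local Open Scope complex_scope.

(* exp (a + i b) = e^a (cos b + i sin b) *)
Definition cexp (R : realType) (z : R[i]) : R[i] :=
  let: a +i* b := z in (expR a * cos b) +i* (expR a * sin b).

Definition ramanujan_sum (R : realType) (n : nat) (k : int) : R[i] :=
  \sum_(1 <= j < n.+1 | coprime j n)
    cexp (2%:R * (pi : R)%:C * 'i%C * j%:R * k%:~R / n%:R).

(* Meant for n > 0 only. *)
Definition mobius (n : nat) : int :=
  if all (fun p => ~~ (p ^ 2 %| n)%N) (primes n)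
  then (-1) ^+ size (primes n) else 0.

Definition lcm_fam (r : nat) (d : 'I_r -> nat) : nat :=
  \big[lcmn/1%N]_(i < r) d i.

(* The condition on x only depends on x modulo lcm_fam d, so residues are
   represented by 0, ..., lcm_fam d - 1. *)
Definition N_G (r : nat) (g : 'I_r -> {poly int}) (d : 'I_r -> nat) : nat :=
  #|[set x : 'I_(lcm_fam d) |
      [forall i : 'I_r, ((d i)%:Z %| (g i).[(x : nat)%:Z])%Z]]|.

Definition E_G (R : realType) (r : nat) (g : 'I_r -> {poly int})
    (m : 'I_r -> nat) : R[i] :=
  (lcm_fam m)%:R^-1 *
    \sum_(1 <= k < (lcm_fam m).+1)
      \prod_(i < r) ramanujan_sum R (m i) (g i).[k%:Z].

(* Main.v *)
Require Import Defs.
From HB Require Import structures.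
From mathcomp Require Import all_boot all_order all_algebra.
From mathcomp Require Import complex.
From mathcomp Require Import reals.
From mathcomp Require Import sequences exp trigo.
From mathcomp Require Import ring lra.

Import Order.TTheory GRing.Theory Num.Theory.
Local Open Scope ring_scope.

(** Detecting [gcd(j, n) = 1] by [\sum_(e | gcd(j, n)) mobius e] and evaluating
    the resulting geometric sums of roots of unity gives
    [c_n(k) = \sum_(d | n, d | k) d * mobius (n / d)].  Expanding the product
    and exchanging summations, what remains for each tuple [d] is the number of
    [1 <= k <= m] with [d_i | g_i(k)] for all [i]; this condition is periodic
    modulo [lcm(d)], which divides [m], so the count is [m / lcm(d) * N_G(d)]. *)

(** * Divisor sums and the Möbius function *)

(** Puts the divisors of different numbers in one common index type, so that a product of divisor
    sums can later be expanded over finite functions. *)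
Lemma big_divisors_ord (V : nmodType) (n M : nat) (F : nat -> V) :
  (0 < n <= M)%N ->
  \sum_(d < M.+1 | (d %| n)%N) F d = \sum_(d <- divisors n) F d.
Proof.
case/andP=> n_gt0 le_nM.
rewrite -(big_mkord (fun d => d %| n)%N F) -big_filter.
apply/perm_big/uniq_perm; rewrite ?filter_uniq ?iota_uniq ?divisors_uniq //.
move=> d; rewrite mem_filter mem_index_iota -dvdn_divisors //=.
apply/andb_idr => d_dvd; rewrite ltnS.
exact: leq_trans (dvdn_leq n_gt0 d_dvd) le_nM.
Qed.

Lemma big_divisors_div (V : nmodType) (n : nat) (F : nat -> V) :
  (0 < n)%N ->
  \sum_(d <- divisors n) F d = \sum_(d <- divisors n) F (n %/ d)%N.
Proof.
move=> n_gt0; rewrite -(big_map (fun d => n %/ d)%N xpredT F).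
have divKdiv d : (d \in divisors n) -> (n %/ (n %/ d))%N = d.
  by rewrite -dvdn_divisors // => /dvdnP[q def_n]; rewrite def_n in n_gt0 *;
     move: n_gt0; rewrite muln_gt0 => /andP[q0 d0]; rewrite mulnK // mulKn.
have div_in d : (d \in divisors n) -> (n %/ d)%N \in divisors n.
  by rewrite -!dvdn_divisors // => /dvdn_div.
apply/perm_big/uniq_perm; rewrite ?divisors_uniq //.
  rewrite map_inj_in_uniq ?divisors_uniq // => d e dn en eq_de.
  by rewrite -(divKdiv d) // eq_de divKdiv.
move=> d; apply/idP/mapP => [dn | [e en ->]]; last exact: div_in.
by exists (n %/ d)%N; rewrite ?divKdiv ?div_in.
Qed.

Lemma mobius_sq (p d : nat) : prime p -> (0 < d)%N -> (p ^ 2 %| d)%N ->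
  mobius d = 0.
Proof.
move=> p_pr d_gt0 p2d; rewrite /mobius ifF //; apply/negbTE/allPn; exists p.
  by rewrite mem_primes p_pr d_gt0 (dvdn_trans _ p2d) // expnS dvdn_mulr.
by rewrite negbK.
Qed.

(** The new prime [p] lengthens the list of prime factors by one, which flips the sign.
    Squarefreeness is unchanged: [q ^ 2] is coprime to [p] for each prime [q] of [d], and [p ^ 2]
    cannot divide [p * d]. *)
Lemma mobius_mul_prime (p d : nat) : prime p -> (0 < d)%N -> ~~ (p %| d)%N ->
  mobius (p * d) = - mobius d.
Proof.
move=> p_pr d_gt0 pNd; have p_gt0 := prime_gt0 p_pr.
have pd_gt0 : (0 < p * d)%N by rewrite muln_gt0 p_gt0.
have prm : perm_eq (primes (p * d)) (p :: primes d).
  apply: uniq_perm; rewrite /= ?primes_uniq ?andbT //.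
    by rewrite mem_primes (negbTE pNd) !andbF.
  by move=> q; rewrite primesM // primes_prime // inE.
rewrite /mobius (perm_all _ prm) (perm_size prm) /=.
rewrite expnS dvdn_pmul2l // expn1 pNd /=.
have -> : all (fun q => ~~ (q ^ 2 %| p * d)%N) (primes d) =
          all (fun q => ~~ (q ^ 2 %| d)%N) (primes d).
  apply: eq_in_all => q; rewrite mem_primes => /and3P[q_pr _ qd].
  rewrite Gauss_dvdr // coprimeXl // prime_coprime // dvdn_prime2 //.
  by apply: contraNneq pNd => <-.
by case: ifP; rewrite ?oppr0 // exprS mulN1r.
Qed.

Lemma sum_mobius (n : nat) : (0 < n)%N ->
  \sum_(d <- divisors n) mobius d = (n == 1%N)%:R.
Proof.
move=> n_gt0; case: eqP => [-> | /eqP n_neq1]; first by rewrite big_seq1.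
have n_gt1 : (1 < n)%N by rewrite ltn_neqAle eq_sym n_neq1.
pose p := pdiv n; have p_pr : prime p := pdiv_prime n_gt1.
have p_gt0 := prime_gt0 p_pr.
have p_dvd : (p %| n)%N by apply: pdiv_dvd.
(* The terms with [p ^ 2 %| d] vanish, and those with [p] exactly dividing [d]
   cancel against those prime to [p] through [d <-> p * d]. *)
rewrite (bigID (fun d => p %| d)%N) /=.
rewrite (bigID (fun d => p ^ 2 %| d)%N) /= big_seq_cond big1 => [|d].
  2: { rewrite -dvdn_divisors // => /andP[dn /andP[_ p2d]].
       exact: mobius_sq (dvdn_gt0 n_gt0 dn) p2d. }
rewrite add0r -big_filter.
have prm : perm_eq
    [seq d <- divisors n | (p %| d)%N && ~~ (p ^ 2 %| d)%N]
    (map (muln p) [seq d <- divisors n | ~~ (p %| d)%N]).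
  apply: uniq_perm; rewrite ?filter_uniq ?divisors_uniq //.
    rewrite map_inj_uniq ?filter_uniq ?divisors_uniq // => a b /eqP.
    by rewrite eqn_pmul2l // => /eqP.
  move=> d; apply/idP/mapP.
    rewrite mem_filter -dvdn_divisors // => /andP[/andP[pd p2d] dn].
    case/dvdnP: pd p2d dn => e ->; rewrite mulnC expnS dvdn_pmul2l // => pe en.
    by exists e; rewrite // mem_filter -dvdn_divisors // pe (dvdn_trans _ en) ?dvdn_mull.
  case=> e; rewrite mem_filter -dvdn_divisors // => /andP[pe en] ->.
  rewrite mem_filter -dvdn_divisors // dvdn_mulr //= expnS dvdn_pmul2l // pe /=.
  by rewrite Gauss_dvd ?p_dvd // prime_coprime.
rewrite (perm_big _ prm) big_map big_filter -big_split /= big_seq_cond big1 // => d /andP[].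
rewrite -dvdn_divisors // => dn pd.
by rewrite mobius_mul_prime ?addNr // (dvdn_gt0 n_gt0 dn).
Qed.

(** The divisors of [gcdn j n] are the divisors of [n] that divide [j], so this is [sum_mobius] at
    the gcd. *)
Lemma coprime_sum_mobius (j n : nat) : (0 < n)%N ->
  (coprime j n)%:R = \sum_(e <- divisors n | (e %| j)%N) mobius e :> int.
Proof.
move=> n_gt0; rewrite /coprime -sum_mobius ?gcdn_gt0 ?n_gt0 ?orbT //.
rewrite -[RHS]big_filter; apply/perm_big/uniq_perm;
  rewrite ?filter_uniq ?divisors_uniq //.
move=> d; rewrite mem_filter -!dvdn_divisors ?gcdn_gt0 ?n_gt0 ?orbT //.
by rewrite dvdn_gcd.
Qed.

(** * Sums over multiples and powers of roots of unity *)

Lemma sum_multiples (V : nmodType) (n e : nat) (F : nat -> V) :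
  (0 < e)%N -> (e %| n)%N ->
  \sum_(1 <= j < n.+1 | (e %| j)%N) F j =
  \sum_(1 <= i < (n %/ e).+1) F (e * i)%N.
Proof.
move=> e_gt0 /dvdnP[q ->]; rewrite mulnK // -big_filter.
rewrite -(big_map (muln e) xpredT F).
apply/perm_big/uniq_perm; rewrite ?filter_uniq ?iota_uniq //.
  rewrite map_inj_uniq ?iota_uniq // => a b /eqP.
  by rewrite eqn_pmul2l // => /eqP.
move=> d; rewrite mem_filter mem_index_iota; apply/idP/mapP.
  case/andP=> /dvdnP[i ->]; rewrite muln_gt0 !ltnS leq_pmul2r //.
  case/andP=> /andP[i0 _] iq.
  by exists i; rewrite 1?mulnC // mem_index_iota i0 ltnS.
case=> i; rewrite mem_index_iota !ltnS => /andP[i0 iq] ->.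
by rewrite dvdn_mulr //= muln_gt0 e_gt0 i0 /= mulnC leq_pmul2r.
Qed.

(** For [x != 1], multiplying the sum by the nonzero [x - 1] telescopes it to
    [x * (x ^+ n - 1) = 0]. *)
Lemma sum_unity_root (F : fieldType) (n : nat) (x : F) : x ^+ n = 1 ->
  \sum_(1 <= j < n.+1) x ^+ j = if x == 1 then n%:R else 0.
Proof.
move=> xn1; case: eqP => [-> | /eqP x_neq1].
  by under eq_bigr do rewrite expr1n; rewrite sumr_const_nat subn1.
have xB1 : x - 1 != 0 by rewrite subr_eq0.
rewrite big_add1 /= big_mkord; apply: (mulfI xB1); rewrite mulr0.
under eq_bigr do rewrite exprS.
by rewrite -mulr_sumr mulrCA -subrX1 xn1 subrr mulr0.
Qed.

(** Integer exponents are needed because the polynomial values fed to the Ramanujan sums may be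
    negative. *)
Lemma prim_exprz_dvd (F : fieldType) (n : nat) (z : F) (a : int) :
  n.-primitive_root z -> (z ^ a == 1) = (n%:Z %| a)%Z.
Proof.
move=> z_prim; rewrite dvdzE /=; case: a => b.
  by rewrite (prim_order_dvd z_prim).
by rewrite NegzE -exprnN invr_eq1 (prim_order_dvd z_prim) abszN.
Qed.

(** * The complex exponential and Ramanujan sums *)

Section ComplexExponential.
Variable R : realType.
Implicit Types z w : R[i].

Lemma cexpD z w : cexp (z + w) = cexp z * cexp w.
Proof.
case: z w => [a b] [c d] /=; rewrite expRD cosD sinD.
by congr Complex; ring.
Qed.

Lemma cexp0 : cexp (0 : R[i]) = 1.
Proof. by rewrite /= expR0 cos0 sin0 mulr1 mulr0. Qed.

Lemma cexp_neq0 z : cexp z != 0.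
Proof.
have : cexp z * cexp (- z) != 0 by rewrite -cexpD subrr cexp0 oner_neq0.
by rewrite mulf_eq0 negb_or => /andP[].
Qed.

Lemma cexpMn z n : cexp (z *+ n) = cexp z ^+ n.
Proof. by elim: n => [|n IHn]; rewrite ?mulr0n ?cexp0 // mulrS exprS cexpD IHn. Qed.

Lemma cexpN z : cexp (- z) = (cexp z)^-1.
Proof. by apply: (mulfI (cexp_neq0 z)); rewrite -cexpD subrr cexp0 mulfV ?cexp_neq0. Qed.

Lemma cexpMz z a : cexp (z *~ a) = cexp z ^ a.
Proof.
case: a => n; first by rewrite -pmulrn cexpMn.
by rewrite NegzE mulrNz cexpN -pmulrn cexpMn exprnN.
Qed.

Definition unity_root (n : nat) : R[i] := cexp (0 +i* (pi *+ 2 / n%:R))%C.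

Lemma unity_rootX n j : unity_root n ^+ j =
  (cos (pi *+ 2 * j%:R / n%:R) +i* sin (pi *+ 2 * j%:R / n%:R))%C.
Proof.
rewrite -cexpMn; have -> : (0 +i* (pi *+ 2 / n%:R))%C *+ j =
    (0 +i* (pi *+ 2 * j%:R / n%:R))%C :> R[i].
  elim: j => [|j IHj]; first by rewrite mulr0n mulr0 mul0r.
  rewrite mulrS IHj; apply/eqP; rewrite eq_complex /= addr0 eqxx /=.
  by apply/eqP; rewrite -[in RHS]natr1; ring.
by rewrite /= expR0 !mul1r.
Qed.

Lemma unity_root_prim n : (0 < n)%N -> n.-primitive_root (unity_root n).
Proof.
move=> n_gt0; have nR_gt0 : 0 < n%:R :> R by rewrite ltr0n.
have root_n : unity_root n ^+ n = 1.
  by rewrite unity_rootX mulfK ?gt_eqF // cos2pi sin2pi.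
have [m] := prim_order_exists n_gt0 root_n.
move=> m_prim m_dvd; have m_gt0 := prim_order_gt0 m_prim.
suff nm : n = m by rewrite [X in X.-primitive_root]nm.
apply/eqP; rewrite eqn_leq (dvdn_leq n_gt0 m_dvd) andbT leqNgt.
apply/negP => lt_mn; have := prim_expr_order m_prim.
rewrite unity_rootX => /eqP; rewrite eq_complex => /andP[/eqP /= + _].
(* [t] is half the argument of [unity_root n ^+ m]. If [m < n], then [t] lies strictly between 0 and
   [pi], so [sin t > 0], whereas [cos (t *+ 2) = 1] forces [sin t = 0]. *)
pose t : R := pi * m%:R / n%:R.
have -> : pi *+ 2 * m%:R / n%:R = t *+ 2 by rewrite /t; ring.
rewrite cos_mulr2n => cos1.
have t_gt0 : 0 < t by rewrite divr_gt0 // mulr_gt0 ?pi_gt0 // ltr0n.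
have t_lt : t < pi.
  by rewrite /t ltr_pdivrMr // ltr_pM2l ?pi_gt0 // ltr_nat.
have sin_gt0 : 0 < sin t by apply: sin_gt0_pi; rewrite t_gt0.
have := cos2Dsin2 t; have : 0 < sin t ^+ 2 by rewrite exprn_gt0.
by move: cos1; rewrite mulr2n; lra.
Qed.

Lemma ramanujan_sum_unity_root n k :
  ramanujan_sum R n k =
  \sum_(1 <= j < n.+1 | coprime j n) (unity_root n ^ k) ^+ j.
Proof.
apply: eq_bigr => j _.
rewrite exprnP exprz_exp -cexpMz; congr cexp.
have -> : (0 +i* (pi *+ 2 / n%:R))%C = pi%:C%C *+ 2 * 'i%C / n%:R :> R[i].
  rewrite -(rmorph_nat (real_complex R) n) -fmorphV -rmorphMn /=.
  by simpc.
by rewrite -[RHS]mulrzr intrM; ring.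
Qed.

Lemma ramanujan_sum_mobius n k : (0 < n)%N ->
  ramanujan_sum R n k =
  \sum_(d <- divisors n)
    d%:R * (mobius (n %/ d))%:~R * ((d%:Z %| k)%Z)%:R.
Proof.
move=> n_gt0; rewrite ramanujan_sum_unity_root.
have z_prim := unity_root_prim _ n_gt0; set z := unity_root n in z_prim *.
transitivity (\sum_(1 <= j < n.+1) \sum_(e <- divisors n | (e %| j)%N)
    (mobius e)%:~R * (z ^ k) ^+ j).
  rewrite big_mkcond; apply: eq_bigr => j _; rewrite -mulr_suml -rmorph_sum /=.
  by rewrite -coprime_sum_mobius //; case: coprime; rewrite ?mul1r ?mul0r.
under eq_bigr do rewrite big_mkcond.
(* Passing to the complementary divisor, [e = n %/ d = q], leaves [d] multiples of [e] in the inner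
   sum; it is then a geometric sum of length [d] and ratio [(z ^ k) ^+ q], which is 1 exactly when
   [d] divides [k]. *)
rewrite exchange_big /= big_divisors_div //; apply: eq_big_seq => d.
rewrite -dvdn_divisors // => /dvdnP[q def_n].
have [q_gt0 d_gt0] : (0 < q)%N /\ (0 < d)%N.
  by apply/andP; rewrite -muln_gt0 -def_n.
have -> : (n %/ d)%N = q by rewrite def_n mulnK.
rewrite -big_mkcond /= sum_multiples ?def_n ?dvdn_mulr // mulKn //.
rewrite -mulr_sumr; under eq_bigr do rewrite exprM.
have zkq1 : ((z ^ k) ^+ q == 1) = (d%:Z %| k)%Z.
  rewrite exprnP exprz_exp (prim_exprz_dvd _ _ _ _ z_prim) def_n mulnC PoszM.
  by rewrite dvdz_mul2r // eqz_nat -lt0n.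
rewrite sum_unity_root ?zkq1; last first.
  rewrite -exprM -def_n exprnP exprz_exp; apply/eqP.
  by rewrite (prim_exprz_dvd _ _ _ _ z_prim) dvdz_mull.
by case: ifP; rewrite ?mulr0 // mulr1 mulrC.
Qed.

End ComplexExponential.

(** * Periodicity modulo the lcm and counting common zeros *)

Lemma horner_dvdz_sub (p : {poly int}) (a b : int) :
  (a - b %| p.[a] - p.[b])%Z.
Proof.
elim/poly_ind: p => [|p c IHp]; first by rewrite !horner0 subrr dvdz0.
rewrite !hornerMXaddC.
have -> : p.[a] * a + c - (p.[b] * b + c) =
          (p.[a] - p.[b]) * a + p.[b] * (a - b) by ring.
apply: rpredD; [exact: dvdz_mulr | exact: dvdz_mull].
Qed.

Lemma sum_periodic (V : nmodType) (L q : nat) (f : nat -> V) :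
  (forall k, f (L + k)%N = f k) ->
  \sum_(1 <= k < (q * L).+1) f k = (\sum_(x < L) f x) *+ q.
Proof.
move=> f_per; have f_perM c k : f (c * L + k)%N = f k.
  by elim: c => // c IHc; rewrite mulSn -addnA f_per.
(* The ranges differ only in their end terms, at [q * L] and at 0, which agree by periodicity. *)
have -> : \sum_(1 <= k < (q * L).+1) f k = \sum_(0 <= k < q * L) f k.
  case: (posnP (q * L)) => [-> | qL_gt0]; first by rewrite !big_geq.
  rewrite big_nat_recr //= [RHS]big_ltn // addrC.
  by rewrite -[X in f X]addn0 f_perM.
elim: q => [|q IHq]; first by rewrite big_geq.
rewrite mulSnr (big_cat_nat (leq0n _) (leq_addr L _)) /= IHq mulrSr; congr +%R.
rewrite -{1}[(q * L)%N]add0n big_addn addKn big_mkord.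
by apply: eq_bigr => x _; rewrite addnC f_perM.
Qed.

Lemma dvdn_lcm_fam (r : nat) (d : 'I_r -> nat) (i : 'I_r) :
  (d i %| lcm_fam d)%N.
Proof. by rewrite /lcm_fam (bigD1 i) //= dvdn_lcml. Qed.

Lemma lcm_fam_dvd (r : nat) (d : 'I_r -> nat) (n : nat) :
  (forall i, d i %| n)%N -> (lcm_fam d %| n)%N.
Proof.
move=> dn; apply: (big_ind (fun x => x %| n)%N) => [||i _]; rewrite ?dvd1n //.
by move=> x y xn yn; rewrite dvdn_lcm xn.
Qed.

Lemma lcm_fam_gt0 (r : nat) (d : 'I_r -> nat) :
  (forall i, 0 < d i)%N -> (0 < lcm_fam d)%N.
Proof.
move=> d_gt0; apply: (big_ind (leq 1)) => // x y x0 y0.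
by rewrite lcmn_gt0 x0.
Qed.

Lemma sum_common_zeros (F : numFieldType) (r : nat) (g : 'I_r -> {poly int})
    (d : 'I_r -> nat) (n : nat) :
  (0 < n)%N -> (forall i, d i %| n)%N ->
  n%:R^-1 * (\sum_(1 <= k < n.+1)
     \prod_(i < r) (((d i)%:Z %| (g i).[k%:Z])%Z)%:R) =
  (lcm_fam d)%:R^-1 * (N_G g d)%:R :> F.
Proof.
move=> n_gt0 dn; have /dvdnP[q def_n] : (lcm_fam d %| n)%N by apply: lcm_fam_dvd.
have [q_gt0 L_gt0] : (0 < q)%N /\ (0 < lcm_fam d)%N.
  by apply/andP; rewrite -muln_gt0 -def_n.
rewrite def_n sum_periodic => [|k].
  have -> : \sum_(x < lcm_fam d)
      \prod_(i < r) (((d i)%:Z %| (g i).[(x : nat)%:Z])%Z)%:R = (N_G g d)%:R :> F.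
    rewrite /N_G -sum1_card natr_sum [RHS]big_mkcond; apply: eq_bigr => x _.
    rewrite inE; case: ifPn => [/forallP dv | ].
      by rewrite big1 // => i _; rewrite dv.
    rewrite negb_forall => /existsP[i /negbTE ndv].
    by rewrite (bigD1 i) //= ndv mul0r.
  by rewrite -mulr_natl natrM; field; rewrite !pnatr_eq0 -!lt0n q_gt0 L_gt0.
(* Periodicity: shifting [k] by [lcm_fam d] changes [g i] by a multiple of [lcm_fam d], hence of
   [d i]. *)
apply: eq_bigr => i _; congr (_%:R); congr nat_of_bool.
rewrite -[(g i).[_]](subrK (g i).[k%:Z]) rpredDl //.
apply: dvdz_trans (horner_dvdz_sub _ _ _).
by rewrite PoszD addrK dvdzE /= dvdn_lcm_fam.
Qed.

(* When all m i > 0, every divisor of m i is at most lcm_fam m, so the finite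
   functions d below range over all tuples (d_1, ..., d_r) with d_i | m_i. *)
Theorem theorem1 (R : realType) (r : nat) (r_gt0 : (0 < r)%N)
    (g : 'I_r -> {poly int}) (m : 'I_r -> nat)
    (m_gt0 : forall i : 'I_r, (0 < m i)%N) :
  E_G R g m =
  \sum_(d : {ffun 'I_r -> 'I_(lcm_fam m).+1} | [forall i : 'I_r, (d i %| m i)%N])
     (\prod_(i < r) ((d i)%:R * (mobius (m i %/ d i))%:~R))
       / (lcm_fam (fun i : 'I_r => d i : nat))%:R
       * (N_G g (fun i : 'I_r => d i : nat))%:R.
Proof.
have M_gt0 := lcm_fam_gt0 _ _ m_gt0.
rewrite /E_G; set M := lcm_fam m in M_gt0 *.
have le_mM i : (0 < m i <= M)%N by rewrite m_gt0 dvdn_leq // dvdn_lcm_fam.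
transitivity (M%:R^-1 * \sum_(1 <= k < M.+1)
    \sum_(d : {ffun 'I_r -> 'I_M.+1} | [forall i : 'I_r, (d i %| m i)%N])
      (\prod_(i < r) ((d i)%:R * (mobius (m i %/ d i))%:~R)) *
      \prod_(i < r) (((d i : nat)%:Z %| (g i).[k%:Z])%Z)%:R : R[i]).
  congr (_ * _); apply: eq_bigr => k _.
  (* All divisor sums now range over the same type ['I_M.+1], as distributivity requires; the choice
     functions it produces are the tuples with [d i] dividing [m i]. *)
  under eq_bigr => i _ do
    rewrite ramanujan_sum_mobius // -(big_divisors_ord _ _ _ _ (le_mM i)).
  rewrite bigA_distr_big_dep; apply: eq_big => [d | d _]; first exact/familyP/forallP.
  by rewrite -big_split.
(* For a fixed tuple the Möbius coefficient does not depend on [k], so only the average of the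
   divisibility indicators over [k] remains. *)
rewrite exchange_big mulr_sumr; apply: eq_bigr => d /forallP dm.
rewrite -mulr_sumr mulrCA -mulrA; congr (_ * _).
by apply: sum_common_zeros => // i; apply: dvdn_trans (dm i) (dvdn_lcm_fam _ _ _).
Qed.
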